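(* Let $K$ be a finite simplicial complex, $\mathcal{V}$ a multivector field on $K$, $N\subseteq K$ closed, $S$ an invariant set isolated by $N$ under $\mathcal{V}$, and $\delta\ge 0$ an integer. If $C_\delta(S)\setminus R$ is the output of the algorithm $\mathtt{find}(S,N,\mathcal{V},\delta)$ (described in the context), then the set $N\cup(C_\delta(S)\setminus R)$ is closed and isolates $S$ under $\mathcal{V}$.
   Context: $K$ is identified with its finite set of simplices; $\sigma\le\sigma'$ means that $\sigma$ is a (not necessarily proper) face of $\sigma'$ (and $\sigma'$ is a coface of $\sigma$). For $A\subseteq K$, $\mathrm{cl}(A)=\{\tau\in K : \tau\le\sigma \text{ for some }\sigma\in A\}$, $\mathrm{cl}(\sigma)=\mathrm{cl}(\{\sigma\})$, $A$ is closed if $\mathrm{cl}(A)=A$, and $\mathrm{mo}(A)=\mathrm{cl}(A)\setminus A$. A multivector is a set $A\subseteq K$ such that $\sigma\le\tau\le\sigma'$ with $\sigma,\sigma'\in A$, $\tau\in K$ implies $\tau\in A$. A multivector field $\mathcal{V}$ on $K$ is a partition of $K$ into multivectors; $[\sigma]_{\mathcal{V}}$ is the element of $\mathcal{V}$ containing $\sigma$. A multivector $V$ is critical if the relative simplicial homology $H_p(\mathrm{cl}(V),\mathrm{mo}(V))\neq 0$ for some $p$, and regular otherwise. $F_{\mathcal{V}}(\sigma)=\mathrm{cl}(\sigma)\cup[\sigma]_{\mathcal{V}}$. A path (under $\mathcal{V}$) is a map $\rho:\mathbb{Z}\cap[a,b]\to K$ with $\rho(i)\in F_{\mathcal{V}}(\rho(i-1))$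 for all integers $a<i\le b$. A solution is a map $\rho:\mathbb{Z}\to K$ with $\rho(i)\in F_{\mathcal{V}}(\rho(i-1))$ for all $i$. It is essential if for each $i$ with $[\rho(i)]_{\mathcal{V}}$ regular there are $i^-<i<i^+$ with $[\rho(i^-)]_{\mathcal{V}}\ne[\rho(i)]_{\mathcal{V}}\ne[\rho(i^+)]_{\mathcal{V}}$. A set $A\subseteq K$ is invariant if every $\sigma\in A$ satisfies $\sigma=\rho(0)$ for some essential solution $\rho$ with $\rho(\mathbb{Z})\subseteq A$. An invariant set $S\subseteq N$, $N$ closed, is isolated by $N$ ($N$ isolates $S$) if every path with values in $N$ and both endpoints in $S$ has all its values in $S$. $\delta$-collar $C_\delta(S)$: $C_0(S)=\mathrm{cl}(S)$; for $\delta>0$, $C_\delta(S)$ consists of the simplices of $C_{\delta-1}(S)$ together with all simplices $\tau$ that are a face of some $\sigma\in K$ having a face $\tau'\in C_{\delta-1}(S)$. Push backward: $\mathrm{pb}_N(S)$ is the set of $x\in N$ for which there is a path with values in $N$ from $x$ to an element of $S$. Algorithm $\mathtt{find}(S,N,\mathcal{V},\delta)$: Start with an empty stack $V$, $R=\emptyset$, $pb=\mathrm{pb}_N(S)$, and all simplices of $C_\delta(S)\cup N$ marked unvisited. For each $\sigma\in S$ and each $\tau\in\mathrm{cl}(\sigma)\cup[\sigma]_{\mathcal{V}}$, if $\tau\notin S$ and $\tau\in C_\delta(S)\cup N$, push $\tau$ onto $V$. While $V$ is nonempty: pop $v$ from $V$; if $v$ has not been visited, mark it visited, and then: if $(\mathrm{cl}(v)\cup[v]_{\mathcal{V}})\cap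 pb\neq\emptyset$, add $v$ and all cofaces of $v$ to $R$; otherwise push onto $V$ every $\sigma\in(\mathrm{cl}(v)\cup[v]_{\mathcal{V}})\cap(C_\delta(S)\cup N)$. When $V$ is empty, output $C_\delta(S)\setminus R$. *)

(* Defs.v *)
From Stdlib Require Import Relation_Operators.
From HB Require Import structures.
From mathcomp Require Import all_boot all_order all_algebra.
From mathcomp Require Import boolp.

Set Implicit Arguments.
Unset Strict Implicit.
Unset Printing Implicit Defensive.

Import Order.TTheory GRing.Theory Num.Theory.
Local Open Scope ring_scope.

(* A simplex is its vertex set, of type {set T}, so "is a face of" is set
   inclusion, and a complex K is identified with the set of its simplices.
   T is only an ambient type: its elements need not be vertices of K. *)
Section Complexes.
Variables (T : finType) (K : {set {set T}}).
Implicit Types (A : {set {set T}}) (s t : {set T}).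

Definition simplicial_complex : Prop :=
  set0 \notin K /\
  forall s t, s \in K -> t \subset s -> t != set0 -> t \in K.

Definition cl A : {set {set T}} :=
  [set t in K | [exists s in A, t \subset s]].

Definition is_closed A : Prop := cl A = A.

Definition mo A : {set {set T}} := cl A :\: A.

Definition cofaces s : {set {set T}} := [set t in K | s \subset t].

Fixpoint collar (A : {set {set T}}) (delta : nat) : {set {set T}} :=
  if delta is d.+1 then
    collar A d :|:
    [set t in K | [exists s in K, (t \subset s) &&
                     [exists t' in collar A d, t' \subset s]]]
  else cl A.

Definition multivector A : Prop :=
  A \subset K /\
  forall s t s', s \in A -> s' \in A -> t \in K ->
    s \subset t -> t \subset s' -> t \in A.

Definition multivector_field (V : {set {set {set T}}}) : Prop :=
  partition V K /\ forall A, A \in V -> multivector A.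

End Complexes.

Section RelativeHomology.
Variables (R : comNzRingType) (T : finType).

(* The order in which enum T lists T orients all simplices: enum s lists the
   vertices v_0, v_1, ... of s in that order. *)
Local Notation chain := {ffun {set T} -> R}.

Definition chains (p : nat) (A : {set {set T}}) : {pred chain} :=
  fun c => [forall s, (c s != 0) ==> (s \in A) && (#|s| == p.+1)].

(* The coefficient at set0 is discarded: homology is not augmented, so the
   boundary of a 0-chain is 0. *)
Definition boundary (c : chain) : chain :=
  [ffun t => if t == set0 then 0
             else \sum_(s : {set T}) \sum_(v in s | s :\ v == t)
                    (-1) ^+ index v (enum s) * c s].

Lemma boundaryB : {morph boundary : c d / c - d}.
Proof.
move=> c d; apply/ffunP => t; rewrite !ffunE; case: ifP => _; first by rewrite subr0.
rewrite -sumrB; apply: eq_bigr => s _; rewrite -sumrB; apply: eq_bigr => v _.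
by rewrite !ffunE mulrBr.
Qed.

Lemma boundary0 : boundary 0 = 0.
Proof. by have := boundaryB 0 0; rewrite subrr subrr. Qed.

Lemma chains_zmod_closed p A : zmod_closed (chains p A).
Proof.
split=> [|c d /forallP hc /forallP hd].
  by apply/forallP => s; rewrite ffunE eqxx.
apply/forallP => s; apply/implyP; rewrite !ffunE => h.
have [c0|/(implyP (hc s))//] := eqVneq (c s) 0.
by apply: (implyP (hd s)); apply: contra h => /eqP ->; rewrite c0 subrr.
Qed.
HB.instance Definition _ p A :=
  GRing.isZmodClosed.Build chain (chains p A) (chains_zmod_closed p A).

Variables (p : nat) (A B : {set {set T}}).

(* Chains of A whose boundary is supported in B; that boundary automatically
   has degree p - 1. *)
Definition rel_cycles : {pred chain} :=
  fun c => (c \in chains p A) &&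
           [forall s, (boundary c s != 0) ==> (s \in B)].

Lemma rel_cycles_zmod_closed : zmod_closed rel_cycles.
Proof.
split=> [|c d /andP[hc /forallP bc] /andP[hd /forallP bd]]; apply/andP; split.
- exact: rpred0.
- by apply/forallP => s; rewrite boundary0 ffunE eqxx.
- exact: rpredB.
apply/forallP => s; apply/implyP; rewrite boundaryB !ffunE => h.
have [c0|/(implyP (bc s))//] := eqVneq (boundary c s) 0.
apply: (implyP (bd s)); apply: contra h => /eqP d0.
by move: c0 d0; rewrite !ffunE => -> ->; rewrite subrr.
Qed.
HB.instance Definition _ :=
  GRing.isZmodClosed.Build chain rel_cycles rel_cycles_zmod_closed.

Record rel_cycle := RelCycle
  { rel_cycle_val : chain; _ : rel_cycle_val \in rel_cycles }.
HB.instance Definition _ := [isSub for rel_cycle_val].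
HB.instance Definition _ := [Choice of rel_cycle by <:].
HB.instance Definition _ := [SubChoice_isSubZmodule of rel_cycle by <:].

Definition rel_boundaries : {pred rel_cycle} :=
  fun z => `[< exists2 d : chain,
                 d \in chains p.+1 A & val z - boundary d \in chains p B >].

Lemma rel_boundaries_zmod_closed : zmod_closed rel_boundaries.
Proof.
split=> [|x y /asboolP[d hd xd] /asboolP[e he ye]]; apply/asboolP.
  by exists 0; rewrite ?rpred0 // boundary0 subr0 raddf0 rpred0.
exists (d - e); first exact: rpredB.
have -> : val (x - y) - boundary (d - e) =
    (val x - boundary d) - (val y - boundary e).
  by rewrite boundaryB raddfB /= !opprD !opprK !addrA; congr (_ + _); rewrite addrAC.
exact: rpredB.
Qed.
HB.instance Definition _ :=
  GRing.isZmodClosed.Build rel_cycle rel_boundaries rel_boundaries_zmod_closed.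

(* H_p(A, B; R) as an additive group. *)
Definition rel_homology : zmodType := Quotient.quot rel_boundaries.

End RelativeHomology.

Section Dynamics.
(* R is the coefficient ring of homology. *)
Variables (R : comNzRingType) (T : finType).
Variables (K : {set {set T}}) (V : {set {set {set T}}}).
Implicit Types (A N S : {set {set T}}) (s : {set T}) (rho : int -> {set T}).

Definition critical A : Prop :=
  exists p, exists h : rel_homology R p (cl K A) (mo K A), h != 0.

Definition regular A : Prop := ~ critical A.

(* For V a partition, pblock V s is the element of V containing s. *)
Definition F s : {set {set T}} := cl K [set s] :|: pblock V s.

(* The map is total; only its values on the integers of [a, b] matter. *)
Definition mv_path (a b : int) rho : Prop :=
  [/\ a <= b,
      forall i, a <= i <= b -> rho i \in K
    & forall i, a < i <= b -> rho i \in F (rho (i - 1))].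

Definition solution rho : Prop :=
  (forall i, rho i \in K) /\ forall i, rho i \in F (rho (i - 1)).

Definition essential_solution rho : Prop :=
  solution rho /\
  forall i, regular (pblock V (rho i)) ->
    exists im ip, [/\ im < i, i < ip,
      pblock V (rho im) <> pblock V (rho i)
    & pblock V (rho i) <> pblock V (rho ip)].

Definition invariant_set A : Prop :=
  A \subset K /\
  forall s, s \in A -> exists rho,
    [/\ essential_solution rho, rho 0 = s & forall i, rho i \in A].

Definition isolates N S : Prop :=
  [/\ invariant_set S, is_closed K N, S \subset N
    & forall a b rho, mv_path a b rho ->
        (forall i, a <= i <= b -> rho i \in N) ->
        rho a \in S -> rho b \in S ->
        forall i, a <= i <= b -> rho i \in S].

(* `[< P >] is the truth value of the proposition P. *)
Definition push_backward N S : {set {set T}} :=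
  [set x in N | `[< exists a b rho,
     [/\ mv_path a b rho, forall i, a <= i <= b -> rho i \in N,
         rho a = x & rho b \in S] >]].

End Dynamics.

Section Find.
Variables (T : finType) (K : {set {set T}}) (V : {set {set {set T}}}).
Variables (S N : {set {set T}}) (delta : nat).

Local Notation D := (collar K S delta :|: N).
Local Notation pb := (push_backward K V N S).

Record find_state := FindState
  { stack : seq {set T}; visited : {set {set T}}; removed : {set {set T}} }.

(* One pass of the while loop. The top of the stack is the head of the list.
   The order in which simplices are pushed is left open, both here and in
   find_init. *)
Inductive find_step : find_state -> find_state -> Prop :=
| FindSkip v st (vis rm : {set {set T}}) of v \in vis :
    find_step (FindState (v :: st) vis rm) (FindState st vis rm)
| FindHit v st (vis rm : {set {set T}}) of v \notin vis & F K V v :&: pb != set0 :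
    find_step (FindState (v :: st) vis rm)
              (FindState st (v |: vis) (rm :|: (v |: cofaces K v)))
| FindPush v st (vis rm : {set {set T}}) ws of v \notin vis & F K V v :&: pb = set0
    & perm_eq ws (enum (F K V v :&: D)) :
    find_step (FindState (v :: st) vis rm)
              (FindState (ws ++ st) (v |: vis) rm).

Inductive find_init : find_state -> Prop :=
| FindInit st of
    perm_eq st [seq t | s <- enum S, t <- enum ((F K V s :\: S) :&: D)] :
    find_init (FindState st set0 set0).

Definition find_output (O : {set {set T}}) : Prop :=
  exists x0 (vis rm : {set {set T}}),
    [/\ find_init x0,
        clos_refl_trans _ find_step x0 (FindState [::] vis rm)
      & O = collar K S delta :\: rm].

Lemma find_terminates x : exists vis rm,
  clos_refl_trans _ find_step x (FindState [::] vis rm).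
Proof.
case: x => st vis rm.
have [n] := ubnP #|~: vis|; elim: n => // n IHn in st vis rm *.
elim: st rm => [|v st IHst] rm hn; first by exists vis, rm; apply: rt_refl.
have [hv|hv] := boolP (v \in vis).
  have [vis' [rm' h]] := IHst rm hn; exists vis', rm'.
  by apply: rt_trans h; apply: rt_step; constructor.
have lt_n : (#|~: (v |: vis)| < n)%N.
  rewrite -ltnS; apply: leq_trans hn; rewrite ltnS; apply: proper_card.
  by rewrite setCU setIC -setDE properD1 // inE.
have [h0|h0] := eqVneq (F K V v :&: pb) set0.
  have [vis' [rm' h]] := IHn (enum (F K V v :&: D) ++ st) _ rm lt_n.
  by exists vis', rm'; apply: rt_trans h; apply: rt_step; constructor.
have [vis' [rm' h]] := IHn st _ (rm :|: (v |: cofaces K v)) lt_n.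
by exists vis', rm'; apply: rt_trans h; apply: rt_step; constructor.
Qed.

Lemma find_output_exists : exists O, find_output O.
Proof.
pose st := [seq t | s <- enum S, t <- enum ((F K V s :\: S) :&: D)].
have [vis [rm h]] := find_terminates (FindState st set0 set0).
by exists (collar K S delta :\: rm), (FindState st set0 set0), vis, rm.
Qed.

End Find.

(* Main.v *)
Require Import Defs.
From mathcomp Require Import all_boot all_order all_algebra.
From Stdlib Require Import Relation_Operators.
From mathcomp Require Import boolp.

(** Write M = N ∪ O and pb = pb_N(S). A path in M that leaves S is outside pb
    at that moment, since S is isolated by N, and the search starts from its
    position. The search follows the path from then on: it would stop only at a
    simplex one step away from pb, but such a simplex is in R, hence not in O,
    hence in N, hence in pb. So the path never meets pb again, and in
    particular cannot end in S. Closedness holds because collars are closed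
    under faces and R under cofaces. *)

Set Implicit Arguments.
Unset Strict Implicit.
Unset Printing Implicit Defensive.

Import Order.TTheory GRing.Theory Num.Theory.
Local Open Scope ring_scope.

(** Paths are indexed by integers, so following one step by step amounts to induction on the natural
    number [i - a]. *)
Lemma int_segment_ind (P : int -> Prop) (a b : int) :
  P a -> (forall i, a < i <= b -> P (i - 1) -> P i) ->
  forall i, a <= i <= b -> P i.
Proof.
move=> Pa Pstep i /andP[ai ib].
have [n En] : exists n : nat, i = a + n%:Z.
  by exists `|i - a|%N; rewrite gez0_abs ?subr_ge0 // subrKC.
rewrite {}En {ai} in ib *; elim: n ib => [|n IHn] ib; first by rewrite addr0.
have En : a + n.+1%:Z - 1 = a + n%:Z by rewrite intS (addrC 1) addrA addrK.
apply: Pstep; first by rewrite ib ltrDl.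
by rewrite En; apply: IHn; apply: le_trans ib; rewrite lerD2l lez_nat.
Qed.

Section Closed.
Variables (T : finType) (K : {set {set T}}).
Implicit Types (A B : {set {set T}}) (s t : {set T}).

Lemma is_closedP A :
  is_closed K A <->
  A \subset K /\ forall s t, s \in A -> t \in K -> t \subset s -> t \in A.
Proof.
split=> [clA|[AK down]].
  split=> [|s t sA tK ts]; rewrite -clA.
    by apply/subsetP => t; rewrite inE => /andP[].
  by rewrite inE tK; apply/existsP; exists s; rewrite sA.
apply/setP => t; rewrite inE; apply/andP/idP => [[tK /existsP[s]]|tA].
  by case/andP=> sA; apply: down.
by rewrite (subsetP AK) //; split=> //; apply/existsP; exists t; rewrite tA /=.
Qed.

(** Each simplex added at a stage is a face of some [u] that meets the previous stage, and its own
    faces are faces of the same [u]. *)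
Lemma collar_closed A delta : is_closed K (collar K A delta).
Proof.
apply/is_closedP; elim: delta => [|d [IHK IHdown]] /=.
  split=> [|s t]; first by apply/subsetP => t; rewrite inE => /andP[].
  rewrite !inE => /andP[_ /existsP[u /andP[uA su]]] -> ts.
  by apply/existsP; exists u; rewrite uA (subset_trans ts).
split=> [|s t].
  rewrite subUset IHK; apply/subsetP => t.
  by rewrite inE => /andP[].
rewrite !(inE, in_setU) => /orP[sA|/andP[_ /existsP[u /and3P[uK su eu]]]] tK ts.
  by rewrite (IHdown s).
rewrite tK; apply/orP; right; apply/existsP; exists u.
by rewrite uK (subset_trans ts).
Qed.

Lemma closedU A B : is_closed K A -> is_closed K B -> is_closed K (A :|: B).
Proof.
move=> /is_closedP[AK Adown] /is_closedP[BK Bdown]; apply/is_closedP.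
split=> [|s t]; first by rewrite subUset AK.
rewrite !inE => /orP[sA|sB] tK ts; first by rewrite (Adown s).
by rewrite (Bdown s) ?orbT.
Qed.

Lemma closedD A B :
  (forall s t, s \in B -> t \in K -> s \subset t -> t \in B) ->
  is_closed K A -> is_closed K (A :\: B).
Proof.
move=> Bup /is_closedP[AK Adown]; apply/is_closedP.
split=> [|s t]; first exact: subset_trans (subsetDl _ _) AK.
rewrite !inE => /andP[sB sA] tK ts; rewrite (Adown s) // andbT.
by apply: contra sB => tB; apply: Bup tB _ ts; apply: (subsetP AK).
Qed.

End Closed.

Section PushBackward.
Variables (T : finType) (K : {set {set T}}) (V : {set {set {set T}}}).
Variables (N S : {set {set T}}).
Implicit Types (x y : {set T}) (rho : int -> {set T}).

Local Notation pb := (push_backward K V N S).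

Hypothesis NK : N \subset K.

Lemma sub_push_backward : S \subset N -> S \subset pb.
Proof.
move=> SN; apply/subsetP => x xS; have xN := subsetP SN x xS.
rewrite inE xN; apply/asboolP; exists 0, 0, (fun=> x); split=> //.
split=> // i; first by move=> _; apply: (subsetP NK).
by case/andP=> /lt_le_trans lt0 /lt0; rewrite ltxx.
Qed.

(** A path witnessing [y \in pb] is prolonged to the left by one index, where it takes the value
    [x]. The conclusion keeps track of the index of [y], because isolation is later applied exactly
    there. *)
Lemma push_backward_path x y : x \in N -> y \in F K V x -> y \in pb ->
  exists a b rho, [/\ mv_path K V (a - 1) b rho,
    forall i, a - 1 <= i <= b -> rho i \in N,
    a <= b, rho (a - 1) = x & rho a = y /\ rho b \in S].
Proof.
move=> xN xy; rewrite inE => /andP[yN /asboolP[a [b [rho]]]].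
case=> [[ab rhoK rhoF] rhoN rhoa rhob].
pose rho' i := if i < a then x else rho i.
have lt_pred : a - 1 < a by rewrite gtrDl.
have rho'N i : a - 1 <= i <= b -> rho' i \in N.
  move=> /andP[_ ib]; rewrite /rho'; case: ltP => // ai.
  by apply: rhoN; rewrite ai.
exists a, b, rho'; split=> //; rewrite /rho' ?lt_pred ?ltxx //; last first.
  by rewrite ltNge ab; split.
split=> [|i /rho'N|i /andP[ai ib]].
- exact: le_trans (ltW lt_pred) ab.
- exact: (subsetP NK).
have {}ai : a <= i by rewrite -ltzD1 -ltrBlDr.
(* At [i = a] the step is the new one from [x] to [y]; for larger [i] both [i] and [i - 1] lie on
   the old path. *)
rewrite ltNge ai /=; have [->|ai'] := eqVneq i a; first by rewrite lt_pred rhoa.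
have {}ai' : a < i by rewrite lt_neqAle eq_sym ai'.
by rewrite ltNge -ltzD1 subrK ai' /=; apply: rhoF; rewrite ai'.
Qed.

Lemma push_backward_step x y :
  x \in N -> y \in F K V x -> y \in pb -> x \in pb.
Proof.
move=> xN xy ypb; rewrite inE xN; apply/asboolP.
have [a [b [rho [? ? _ ? [_ ?]]]]] := push_backward_path xN xy ypb.
by exists (a - 1), b, rho.
Qed.

(** The prolonged path runs in [N] from [x] in [S] through [y] to a point of [S], so isolation by
    [N] applies to it. *)
Lemma isolates_push_backward (R : comNzRingType) x y :
  isolates R K V N S -> x \in S -> y \in F K V x -> y \in pb -> y \in S.
Proof.
move=> [_ _ SN iso] xS xy ypb.
have [a [b [rho [rhoP rhoN ab rhoa [rhoa1 rhob]]]]] :=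
  push_backward_path (subsetP SN x xS) xy ypb.
rewrite -rhoa1; apply: iso rhoP rhoN _ rhob _ _; first by rewrite rhoa.
by rewrite ab gerDl.
Qed.

End PushBackward.

Section FindInvariant.
Variables (T : finType) (K : {set {set T}}) (V : {set {set {set T}}}).
Variables (S N : {set {set T}}) (delta : nat).

Local Notation D := (collar K S delta :|: N).
Local Notation pb := (push_backward K V N S).

(** Once the stack is empty, the first two clauses say that every exit from [S] inside [D] has been
    visited, and that a step inside [D] can leave the visited set only from a removed simplex. The
    third clause serves closedness of the output. *)
Definition find_invariant (X : find_state T) : Prop :=
  [/\ forall s y, s \in S -> y \in F K V s -> y \notin S -> y \in D ->
        (y \in visited X) || (y \in stack X),
      forall v, v \in visited X ->
        (F K V v :&: pb != set0 /\ v \in removed X) \/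
        (F K V v :&: pb = set0 /\
         forall y, y \in F K V v -> y \in D ->
           (y \in visited X) || (y \in stack X))
    & forall s t, s \in removed X -> t \in K -> s \subset t ->
        t \in removed X].

Lemma find_init_invariant X : find_init K V S N delta X -> find_invariant X.
Proof.
case=> st /perm_mem Est; split=> [s y sS sy yS yD|v|s t]; rewrite ?inE //=.
rewrite Est; apply/allpairsPdep; exists s, y; split; rewrite ?mem_enum //.
by rewrite in_setI yD in_setD yS sy.
Qed.

(** The popped [v] is already visited or becomes so, hence whatever was visited or pending remains
    so; this is [sub] in each of the three cases. *)
Lemma find_step_invariant X Y :
  find_step K V S N delta X Y -> find_invariant X -> find_invariant Y.
Proof.
case=> [v st vis rm vvis|v st vis rm vvis hit|v st vis rm ws vvis miss].
- case=> /= h1 h2 h3.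
  have sub y : (y \in vis) || (y \in v :: st) -> (y \in vis) || (y \in st).
    by rewrite inE; case: eqP => [->|//]; rewrite vvis.
  split=> //= [s y sS sy yS yD|u /h2[|[u0 hu]]]; first by apply/sub/(h1 s).
    by left.
  by right; split=> // y uy yD; apply/sub/hu.
- case=> /= h1 h2 h3.
  have sub y : (y \in vis) || (y \in v :: st) -> (y \in v |: vis) || (y \in st).
    by rewrite !inE; case: (y == v); case: (y \in vis).
  split=> /= [s y sS sy yS yD|u|s t]; first by apply/sub/(h1 s).
    rewrite in_setU1 => /predU1P[->|/h2[[u0 hu]|[u0 hu]]].
    + by left; rewrite hit !inE eqxx orbT.
    + by left; rewrite u0 inE hu.
    by right; split=> // y uy yD; apply/sub/hu.
  rewrite !inE => /or3P[srm|/eqP->|/andP[sK vs]] tK st'.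
  + by rewrite (h3 s).
  + by rewrite tK st' !orbT.
  by rewrite tK (subset_trans vs st') !orbT.
move=> /perm_mem Ews; case=> /= h1 h2 h3.
have sub y : (y \in vis) || (y \in v :: st) ->
    (y \in v |: vis) || (y \in ws ++ st).
  rewrite mem_cat !inE.
  by case: (y == v); case: (y \in vis); case: (y \in ws).
split=> //= [s y sS sy yS yD|u]; first by apply/sub/(h1 s).
rewrite in_setU1 => /predU1P[->|/h2[|[u0 hu]]]; last 2 first.
- by left.
- by right; split=> // y uy yD; apply/sub/hu.
right; split=> // y vy yD.
by rewrite mem_cat Ews mem_enum in_setI vy yD orbT.
Qed.

Lemma find_run_invariant X Y :
  clos_refl_trans _ (find_step K V S N delta) X Y ->
  find_invariant X -> find_invariant Y.
Proof.
elim=> [x y|x|x y z _ IHxy _ IHyz] => [|//|/IHxy/IHyz//].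
exact: find_step_invariant.
Qed.

End FindInvariant.

Theorem theorem23 (R : comNzRingType) (T : finType) (K : {set {set T}})
    (V : {set {set {set T}}}) (N S : {set {set T}}) (delta : nat)
    (O : {set {set T}})
    (hK : simplicial_complex K) (hV : multivector_field K V)
    (hN : is_closed K N) (hS : invariant_set R K V S) (hNS : isolates R K V N S)
    (hO : find_output K V S N delta O) :
  is_closed K (N :|: O) /\ isolates R K V (N :|: O) S.
Proof.
have [x0 [vis [rm [/find_init_invariant inv0 /find_run_invariant run ->]]]] := hO.
have [/= exits visP rm_up] := run inv0.
set C := collar K S delta in exits visP *; set M := N :|: (C :\: rm).
pose pb := push_backward K V N S.
have Mcl : is_closed K M.
  by apply: closedU => //; apply: closedD => //; apply: collar_closed.
have [_ _ SN _] := hNS; have [NK _] := (is_closedP K N).1 hN.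
have Spb : S \subset pb by apply: sub_push_backward.
(* The search pushes only simplices of [C :|: N]; as [M] lies in it, no step inside [M] is
   overlooked. *)
have MD y : y \in M -> y \in C :|: N.
  by rewrite !inE => /orP[->|/andP[_ ->]]; rewrite ?orbT.
have leave x y : x \in S -> y \in F K V x -> y \in M -> y \notin S ->
    y \in vis :\: pb.
  move=> xS xy /MD yD yS; have := exits x y xS xy yS yD.
  rewrite in_setD in_nil orbF => ->; rewrite andbT; apply: contra yS.
  exact: isolates_push_backward hNS xS xy.
have stay x y : x \in vis :\: pb -> x \in M -> y \in F K V x -> y \in M ->
    y \in vis :\: pb.
  rewrite in_setD => /andP[xpb xvis] xM xy /MD yD.
  (* The hit case contradicts [x \notin pb]. In the other case [F K V x] misses [pb] entirely, so
     [y] is outside [pb] as well as visited. *)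
  have [[/set0Pn[z /setIP[xz zpb]] xrm]|[miss next]] := visP x xvis.
    have xN : x \in N by move: xM; rewrite !inE xrm /= orbF.
    by rewrite (push_backward_step NK xN xz zpb) in xpb.
  have := next y xy yD; rewrite in_setD in_nil orbF => ->; rewrite andbT.
  by apply/negP => ypb; have := in_set0 y; rewrite -miss in_setI xy ypb.
split=> //; split=> //; first exact: subset_trans SN (subsetUl _ _).
move=> a b rho [ab _ rhoF] rhoM rhoa rhob i /andP[ai ib].
have prev j : a < j -> j <= b -> a <= j - 1 <= b.
  by move=> aj jb; rewrite lerBrDr lezD1 aj (le_trans _ jb) ?gerDl.
have either : rho i \in S \/ rho i \in vis :\: pb.
  apply: (@int_segment_ind
    (fun j => rho j \in S \/ rho j \in vis :\: pb) a b); rewrite ?ai //.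
    by left.
  move=> j /andP[aj jb] IHj.
  have jF : rho j \in F K V (rho (j - 1)) by apply: rhoF; rewrite aj.
  have jM : rho j \in M by apply: rhoM; rewrite (ltW aj).
  case: IHj => [jS|jvis]; last first.
    by right; apply: stay jvis (rhoM _ (prev _ aj jb)) jF jM.
  by have [|/(leave _ _ jS jF jM)] := boolP (rho j \in S); [left|right].
(* If [rho i] has already left [S], a second induction, from [i] to [b], keeps the path outside [pb]
   up to [rho b], which lies in [S] and hence in [pb]. *)
case: either => // ivis.
have : rho b \in vis :\: pb.
  apply: (@int_segment_ind (fun j => rho j \in vis :\: pb) i b); rewrite ?ib ?lexx //.
  move=> j /andP[ij jb] jvis; have aj := le_lt_trans ai ij.
  apply: stay jvis (rhoM _ (prev _ aj jb)) _ _; first by apply: rhoF; rewrite aj.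
  by apply: rhoM; rewrite (ltW aj).
by rewrite in_setD (subsetP Spb).
Qed.
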